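(* Let $b,c\in\mathbb{N}$ with $1\leqslant b\leqslant c$. If $3\nmid(1+b+c)$ and $\gcd(1+b+c,\,c^2-b)>1$, then there exists a semi-regular tournament on $n\in(1+b+c)\mathbb{N}$ vertices that does not contain a $D_{1,b,c}$-factor.
   Context: $\delta^0(G)$ is the minimum of all in-degrees and out-degrees of vertices of a digraph $G$. A tournament $G$ on $n$ vertices is semi-regular if $\delta^0(G)=\lfloor (n-1)/2\rfloor$. $TT_k$ is the transitive tournament on $k$ vertices. $D_{a,b,c}$ is the tournament on $a+b+c$ vertices obtained from the directed triangle $C_3$ by replacing its vertices with $TT_a,TT_b,TT_c$, respectively, with all edges directed from $TT_a$ to $TT_b$, from $TT_b$ to $TT_c$, and from $TT_c$ to $TT_a$; $D_{1,b,c}$ is the case $a=1$. An $H$-factor of $G$ is a family of pairwise vertex-disjoint copies of $H$ in $G$ covering all vertices of $G$. $(1+b+c)\mathbb{N}$ denotes the set of positive multiples of $1+b+c$. Convention: $\gcd(p,0)=p$ for every positive integer $p$. *)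

(* Defs.v *)
From mathcomp Require Import all_boot.
Set Implicit Arguments.
Unset Strict Implicit.
Unset Printing Implicit Defensive.

(* A digraph on a finite vertex type T is a relation G : rel T,
   with G x y meaning that the edge xy, directed from x to y, is present. *)

Definition is_tournament (T : finType) (G : rel T) : Prop :=
  irreflexive G /\ forall x y : T, x != y -> G x y (+) G y x.

Definition out_degree (T : finType) (G : rel T) (x : T) : nat :=
  #|[set y | G x y]|.

Definition in_degree (T : finType) (G : rel T) (x : T) : nat :=
  #|[set y | G y x]|.

(* Every degree is at most #|T|, so the default value #|T| does not affect
   the minimum as soon as T is nonempty. *)
Definition min_semidegree (T : finType) (G : rel T) : nat :=
  \big[minn/#|T|]_(x : T) minn (in_degree G x) (out_degree G x).

Definition semi_regular (T : finType) (G : rel T) : Prop :=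
  is_tournament G /\ min_semidegree G = (#|T| - 1) %/ 2.

Definition TT (k : nat) : rel 'I_k := fun i j => i < j.

(* The three summands are the vertex sets of TT_a, TT_b and TT_c. *)
Definition Dabc (a b c : nat) : rel ('I_a + 'I_b + 'I_c)%type :=
  fun x y =>
    match x, y with
    | inl (inl i), inl (inl j) => TT i j
    | inl (inr i), inl (inr j) => TT i j
    | inr i, inr j => TT i j
    | inl (inl _), inl (inr _) => true
    | inl (inr _), inr _ => true
    | inr _, inl (inl _) => true
    | _, _ => false
    end.

(* A copy of H in G (a not necessarily induced subgraph of G isomorphic to H)
   is given by an injective edge-preserving map. *)
Definition is_copy (S T : finType) (H : rel S) (G : rel T) (f : S -> T) : Prop :=
  injective f /\ forall x y : S, H x y -> G (f x) (f y).

Definition has_factor (S T : finType) (H : rel S) (G : rel T) : Prop :=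
  exists (k : nat) (f : 'I_k -> S -> T),
    [/\ forall i : 'I_k, is_copy H G (f i),
        forall i j : 'I_k, i != j -> [disjoint codom (f i) & codom (f j)]
      & forall v : T, exists i : 'I_k, v \in codom (f i)].

(* Main.v *)
Require Import Defs.
From mathcomp Require Import all_boot.
From mathcomp Require Import zify ring.

(** Split the vertices [0, ..., n-1] into the residue classes modulo 3, all edges
    going from each class to the next one, and inside a class put a
    near-regular tournament. If [n] is even and not divisible by 3, the result
    is semi-regular. Since a class only sends edges to itself and the next one,
    a copy of [D_{1,b,c}] lies in one class or meets the three classes in
    [1, b, c] vertices, up to rotation.  Let [g] divide both [1+b+c] and
    [c^2-b]; then [b^2+b+1 = 0] modulo [g], and giving the vertex [x] the weight
    [b^(x mod 3)] makes every copy weigh 0 modulo [g]. The total weight of the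
    tournament is however [1] or [1+b = -b^2] modulo [g], a unit because
    [b^3 = 1]. Thus [n = 2(1+b+c)] works. *)

(** Elements of a class are multiples of 3 apart, so [x + y] has the parity of their distance within
    the class: edges go up an odd and down an even number of places, which nearly balances the
    degrees. *)
Definition class_tournament (n : nat) : rel 'I_n := fun x y =>
  if x %% 3 == y %% 3 then (x != y) && ((x < y) == odd (x + y))
  else y %% 3 == (x + 1) %% 3.

Definition weight (b x : nat) : nat := b ^ (x %% 3).

Lemma class_tournamentP n : is_tournament (class_tournament n).
Proof.
split=> [x|x y neq_xy]; first by rewrite /class_tournament !eqxx.
have neq: (x : nat) <> y by apply/eqP.
rewrite /class_tournament (eq_sym y x) neq_xy (addnC y x) (eq_sym (y %% 3) (x %% 3)).
case: (eqVneq (x %% 3) (y %% 3)) => [_|ne3]; last by lia.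
by case: ltngtP neq => // _ _ /=; case: odd.
Qed.

Lemma class_tournament_succ n (x y : 'I_n) :
  class_tournament n x y -> y %% 3 = x %% 3 \/ y %% 3 = (x + 1) %% 3.
Proof. by rewrite /class_tournament; case: eqP => [->|_ /eqP]; [left | right]. Qed.

(* The three terms count the out-neighbours of [x] below [k]: those in the next
   class, then those in the class of [x], below and above [x]. *)
Lemma sum_class_tournament (x k : nat) :
  \sum_(0 <= y < k)
    (if x %% 3 == y %% 3 then (x != y) && ((x < y) == odd (x + y))
     else y %% 3 == (x + 1) %% 3) =
  (k + 2 - (x + 1) %% 3) %/ 3 + (minn k x + 5 - x %% 6) %/ 6 + (k - x + 2) %/ 6.
Proof.
elim: k => [|k IHk]; first by rewrite big_geq //; lia.
rewrite big_nat_recr //= {}IHk.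
case: (eqVneq (x %% 3) (k %% 3)) => ?; last by lia.
case: (ltngtP x k) => ? /=; lia.
Qed.

(** Two classes have the same odd size and the third differs from it by 1. A vertex of an odd class
    is balanced inside it and off by 1 towards the other classes; in the even class it is the other
    way round. *)
Lemma class_tournament_degrees n (x : 'I_n) : ~~ odd n -> ~~ (3 %| n) ->
  minn (in_degree (class_tournament n) x) (out_degree (class_tournament n) x)
  = (n - 1) %/ 2.
Proof.
move=> even_n ndiv3.
have out_x : out_degree (class_tournament n) x =
    (n + 2 - (x + 1) %% 3) %/ 3 + (minn n x + 5 - x %% 6) %/ 6 + (n - x + 2) %/ 6.
  rewrite -sum_class_tournament big_mkord /out_degree -sum1dep_card big_mkcond /=.
  apply: eq_bigr => y _; rewrite /class_tournament.
  by rewrite -[x == y]/(x == y :> nat); case: ifP; case: (_ && _); case: (_ == _).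
have in_out : in_degree (class_tournament n) x + out_degree (class_tournament n) x = n - 1.
  have [irr tot] := class_tournamentP n.
  rewrite /in_degree /out_degree -cardsUI.
  have -> : [set y | class_tournament n y x] :&: [set y | class_tournament n x y] = set0.
    apply/setP=> y; rewrite !inE.
    have [->|/tot] := eqVneq y x; first by rewrite irr.
    by do 2!case: class_tournament.
  have -> : [set y | class_tournament n y x] :|: [set y | class_tournament n x y] = [set~ x].
    apply/setP=> y; rewrite !inE.
    have [->|/tot] := eqVneq y x; first by rewrite irr.
    by do 2!case: class_tournament.
  by rewrite cards0 addn0 cardsC1 card_ord subn1.
have lt_xn := ltn_ord x.
lia.
Qed.

Lemma class_tournament_semi_regular n : 0 < n -> ~~ odd n -> ~~ (3 %| n) ->
  semi_regular (class_tournament n).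
Proof.
move=> n_gt0 even_n ndiv3; split; first exact: class_tournamentP.
rewrite /min_semidegree.
under eq_bigr do rewrite class_tournament_degrees //.
rewrite big_const card_ord.
(* As [n] is positive, the first [minn] replaces the default value, and the others change
   nothing. *)
case: n n_gt0 {even_n ndiv3} => // n _.
elim: {1}n => [|k /= ->]; last by rewrite minnn.
by rewrite /=; lia.
Qed.

(* Each edge of a directed triangle advances the class by 0 or 1, and the total
   advance is a multiple of 3, so all three edges advance it by the same [e]. *)
Lemma copy_D1bc_classes n b c (f : 'I_1 + 'I_b + 'I_c -> 'I_n) :
    0 < b -> 0 < c -> is_copy (@Dabc 1 b c) (class_tournament n) f ->
  exists a e, e < 2 /\
    [/\ forall i, f (inl (inl i)) %% 3 = a %% 3,
        forall i, f (inl (inr i)) %% 3 = (a + e) %% 3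
      & forall i, f (inr i) %% 3 = (a + 2 * e) %% 3].
Proof.
move=> b_gt0 c_gt0 [_ f_edge].
have edge x y : Dabc x y -> f y %% 3 = f x %% 3 \/ f y %% 3 = (f x + 1) %% 3.
  by move/f_edge/class_tournament_succ.
pose j0 := Ordinal b_gt0; pose k0 := Ordinal c_gt0.
have triangle j k := conj (edge (inl (inl ord0)) (inl (inr j)) isT)
  (conj (edge (inl (inr j)) (inr k) isT) (edge (inr k) (inl (inl ord0)) isT)).
exists (f (inl (inl ord0)) : nat), (f (inl (inr j0)) %% 3 != f (inl (inl ord0)) %% 3 : nat).
split; first by case: (_ != _).
split=> [i|j|k]; first by rewrite (ord1 i).
(* The two triangles share the edge leaving [k0], hence have the same advance. *)
- by have := triangle j k0; have := triangle j0 k0; lia.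
- by have := triangle j0 k; lia.
Qed.

Section Weights.

Variables (g b c : nat).
Hypotheses (g_dvd_m : g %| 1 + b + c) (g_dvd_b : g %| b ^ 2 + b + 1).

(** Modulo [g], [c = -(1 + b) = b^2] and [b^3 = 1], so a copy meeting three classes, with its apex
    in class [a], weighs [b^a * (1 + b^2 + b^4) = 0]. *)
Lemma dvdn_weight_copy n (f : 'I_1 + 'I_b + 'I_c -> 'I_n) :
    0 < b -> 0 < c -> is_copy (@Dabc 1 b c) (class_tournament n) f ->
  g %| \sum_s weight b (f s).
Proof.
move=> b_gt0 c_gt0 /(copy_D1bc_classes _ _ _ _ b_gt0 c_gt0) [a [e [lt_e2 [fa fb fc]]]].
rewrite !big_sumType /= big_ord1 /weight.
under eq_bigr do rewrite fb.
under [X in _ + X]eq_bigr do rewrite fc.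
rewrite fa !sum_nat_const !card_ord -(modnDml a e) -(modnDml a (2 * e)).
have: a %% 3 < 3 by rewrite ltn_mod.
case: e lt_e2 {fa fb fc} => [|[|//]] _.
  rewrite muln0 addn0 modn_mod => _; set w := _ ^ _.
  by rewrite -[X in X + _ + _]mul1n -!mulnDl dvdn_mulr.
case: (a %% 3) => [|[|[|//]]] _.
- rewrite -[X in g %| X]/(b ^ 0 + b * b ^ 1 + c * b ^ 2) expn0 expn1.
  rewrite -(@dvdn_addl (b * (b ^ 2 + b + 1))) ?dvdn_mull //.
  have -> : 1 + b * b + c * b ^ 2 + b * (b ^ 2 + b + 1) =
            b ^ 2 * (1 + b + c) + (b ^ 2 + b + 1) by ring.
  by rewrite dvdn_add ?dvdn_mull.
- rewrite -[X in g %| X]/(b ^ 1 + b * b ^ 2 + c * b ^ 0) expn0 expn1 muln1.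
  rewrite -(@dvdn_addl (b ^ 2 + b + 1)) //.
  have -> : b + b * b ^ 2 + c + (b ^ 2 + b + 1) =
            (1 + b + c) + b * (b ^ 2 + b + 1) by ring.
  by rewrite dvdn_add ?dvdn_mull.
- rewrite -[X in g %| X]/(b ^ 2 + b * b ^ 0 + c * b ^ 1) expn0 expn1 muln1.
  have -> : b ^ 2 + b + c * b = b * (1 + b + c) by ring.
  by rewrite dvdn_mull.
Qed.

(** Three consecutive vertices weigh [1 + b + b^2] in total, so only the last [n %% 3] vertices
    count. *)
Lemma ndvdn_weight_total n : 1 < g -> ~~ (3 %| n) ->
  ~~ (g %| \sum_(x < n) weight b x).
Proof.
move=> g_gt1 ndiv3.
have periodic q : g %| \sum_(0 <= x < q * 3) weight b x.
  elim: q => [|q IHq]; first by rewrite big_geq.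
  rewrite mulSn addnC !addnS addn0 !big_nat_recr //= -!addnA.
  rewrite dvdn_add // /weight modnMl -[(q * 3).+2]addn2 -[(q * 3).+1]addn1 !modnMDl.
  rewrite -[X in g %| X]/(b ^ 0 + (b ^ 1 + b ^ 2)) expn0 expn1.
  by have -> : 1 + (b + b ^ 2) = b ^ 2 + b + 1 by ring.
have ndvd1 : ~~ (g %| 1) by rewrite dvdn1; case: (g) g_gt1 => [|[|]].
rewrite -(big_mkord xpredT (weight b)) (divn_eq n 3).
have: n %% 3 < 3 by rewrite ltn_mod.
move: ndiv3; rewrite [3 %| n]/dvdn.
case: (n %% 3) => [|[|[|//]]] // _ _.
  by rewrite addn1 big_nat_recr //= dvdn_addr // /weight modnMl.
rewrite addn2 !big_nat_recr //= -addnA dvdn_addr // /weight modnMl -addn1 modnMDl.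
apply: contra ndvd1; rewrite expn0 expn1 => g_dvd.
rewrite -(@dvdn_addl ((1 + b) * b)) ?dvdn_mulr //.
by have -> : 1 + (1 + b) * b = b ^ 2 + b + 1 by ring.
Qed.

End Weights.

Lemma dvdn_sum_factor (S T : finType) (H : rel S) (G : rel T) (g : nat) (w : T -> nat) :
    (forall f, is_copy H G f -> g %| \sum_s w (f s)) ->
  has_factor H G -> g %| \sum_x w x.
Proof.
move=> dvd_copy [k [f [f_copy f_disj f_cover]]].
(* [h] is a bijection onto the vertices: disjointness makes it injective, covering makes it onto. *)
pose h (p : 'I_k * S) := f p.1 p.2.
have h_inj : injective h.
  move=> [i s] [j t]; rewrite /h /= => eq_f.
  have eq_ij : i = j.
    apply/eqP/negPn/negP => /f_disj/disjointFr/(_ (codom_f (f i) s)).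
    by rewrite eq_f codom_f.
  by move: eq_f; rewrite eq_ij => /(proj1 (f_copy j)) ->.
have enum_h : perm_eq (index_enum T) (map h (index_enum _)).
  apply: uniq_perm; rewrite ?index_enum_uniq // ?map_inj_uniq ?index_enum_uniq // => x.
  have [i /codomP [s ->]] := f_cover x.
  by rewrite mem_index_enum -[f i s]/(h (i, s)) map_f ?mem_index_enum.
rewrite (perm_big _ enum_h) big_map /= -(pair_bigA _ (fun i s => w (f i s))) /=.
by apply: dvdn_sum => i _; apply: dvd_copy.
Qed.

Theorem proposition1p7 (b c : nat) (hb : 1 <= b) (hbc : b <= c)
    (h3 : ~~ (3 %| 1 + b + c))
    (hgcd : 1 < gcdn (1 + b + c) (c ^ 2 - b)) :
  exists (n : nat) (G : rel 'I_n),
    [/\ 0 < n, 1 + b + c %| n, semi_regular G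
      & ~ has_factor (@Dabc 1 b c) G].
Proof.
have ndiv3 : ~~ (3 %| 2 * (1 + b + c)) by rewrite Euclid_dvdM.
exists (2 * (1 + b + c)), (class_tournament _).
split; [by [] | exact: dvdn_mull | |].
  by apply: class_tournament_semi_regular => //; rewrite oddM.
pose g := gcdn (1 + b + c) (c ^ 2 - b).
have g_dvd_m : g %| 1 + b + c by exact: dvdn_gcdl.
have g_dvd_b : g %| b ^ 2 + b + 1.
  (* Substituting [c = -(1 + b)] modulo [g] turns [c^2 - b] into [b^2 + b + 1]; the added multiple
     of [1 + b + c] keeps the identity in [nat]. *)
  rewrite -(@dvdn_addl (c * (1 + b + c))) ?dvdn_mull //.
  have le_bc2 : b <= c ^ 2 by nia.
  have -> : b ^ 2 + b + 1 + c * (1 + b + c) = (c ^ 2 - b) + (1 + b) * (1 + b + c) by nia.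
  by rewrite dvdn_add ?dvdn_gcdr ?dvdn_mull.
have := ndvdn_weight_total g b g_dvd_b _ hgcd ndiv3.
move=> /negP ndvd_total factor; apply: ndvd_total.
apply: dvdn_sum_factor factor => f; apply: (dvdn_weight_copy g b c) => //.
exact: leq_trans hbc.
Qed.
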